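(* Let $\theta=(\theta_{AB|CD},\theta_{BC|AD})$ with $0<\theta_{AB|CD}<1$ and $\theta_{BC|AD}=1-\theta_{AB|CD}$, and let $\mathsf U_2=\sum_{i=1}^2e_i\otimes e_i\otimes e_i\otimes e_i\in(\mathbb C^2)^{\otimes 4}$. Then $$E^\theta(\mathsf U_2)\ \ge\ \tfrac32\,\theta_{AB|CD}+\theta_{BC|AD}\ >\ 1.$$
   Context: Legs of a $4$-tensor $\psi\in V=V_A\otimes V_B\otimes V_C\otimes V_D$ are labelled $A,B,C,D$; $V_S=\bigotimes_{i\in S}V_i$. $\theta$ is a probability distribution supported on the two bipartitions $AB|CD$ and $BC|AD$. For a bipartition $S|\overline S$, $n\ge1$ and a partition $\lambda\vdash n$, $P_\lambda^{S|\overline S}=P_\lambda^{V_S}P_{(n)}^{V}$, where $P_\lambda^{V_S}$ is the projector on $V^{\otimes n}\cong V_S^{\otimes n}\otimes V_{\overline S}^{\otimes n}$ onto the $\lambda$-isotypic component for the symmetric group $S_n$ permuting the tensor factors of $V_S^{\otimes n}$ (acting trivially on $V_{\overline S}^{\otimes n}$), and $P_{(n)}^{V}$ is the projector onto the symmetric subspace of $V^{\otimes n}$. The operators for $AB|CD$ and $BC|AD$ need not commute; the logarithmic upper quantum functional is defined with the fixed order $$E^\theta(\psi)=\sup\Big\{\theta_{AB|CD}H\big(\tfrac{\lambda_{AB|CD}}n\big)+\theta_{BC|AD}H\big(\tfrac{\lambda_{BC|AD}}n\big)\ :\ n\ge1,\ \lambda_{AB|CD},\lambda_{BC|AD}\vdash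 n,\ P^{AB|CD}_{\lambda_{AB|CD}}P^{BC|AD}_{\lambda_{BC|AD}}\psi^{\otimes n}\ne0\Big\},$$ where $H$ is Shannon entropy (base 2). *)

(* Defs.v *)
From HB Require Import structures.
From mathcomp Require Import all_boot all_order all_algebra all_fingroup.
From mathcomp Require Import complex.
From mathcomp Require Import all_classical all_reals all_analysis.

Set Implicit Arguments.
Unset Strict Implicit.
Unset Printing Implicit Defensive.

Import Order.TTheory GRing.Theory Num.Theory.

Local Open Scope ring_scope.

Definition is_intpart (n : nat) (lam : seq nat) : bool :=
  [&& sumn lam == n, sorted geq lam & 0%N \notin lam].

Section SpechtModule.
Variables (R : realType) (n : nat).

Definition groupAlg := {ffun 'S_n -> R[i]^o}.

(* Left multiplication by s: the basis element h goes to s * h. *)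
Definition lmulAlg (s : 'S_n) (x : groupAlg) : groupAlg :=
  [ffun g => x (s^-1 * g)%g].

(* Row and column groups of the tableau of shape lam filled with 0, ..., n-1
   in reading order: the entry t lies in row [reshape_index lam t] and in
   column [reshape_offset lam t]. *)
Definition rowGroup (lam : seq nat) : {set 'S_n} :=
  [set s : 'S_n | [forall t : 'I_n,
    reshape_index lam (s t) == reshape_index lam t]].

Definition colGroup (lam : seq nat) : {set 'S_n} :=
  [set s : 'S_n | [forall t : 'I_n,
    reshape_offset lam (s t) == reshape_offset lam t]].

Definition youngSymmetrizer (lam : seq nat) : groupAlg :=
  [ffun g => \sum_(p in rowGroup lam) \sum_(q in colGroup lam | (p * q)%g == g)
     (-1) ^+ (odd_perm q)].

(* The Specht module [lam], as the left ideal of the group algebra generated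
   by the Young symmetrizer. *)
Definition specht (lam : seq nat) : {vspace groupAlg} :=
  <<[seq lmulAlg s (youngSymmetrizer lam) | s : 'S_n]>>%VS.

(* [act] is meant to be a linear action of 'S_n.  M is a subrepresentation
   isomorphic to [lam]; a linear map on the submodule [specht lam] is
   represented by a linear extension of it to the whole group algebra. *)
Definition spechtCopy (W : vectType R[i]) (act : 'S_n -> W -> W)
    (lam : seq nat) (M : {vspace W}) : Prop :=
  exists f : 'Hom(groupAlg, W),
    [/\ {in specht lam &, injective f},
        (forall (s : 'S_n) (x : groupAlg), x \in specht lam ->
           f (lmulAlg s x) = act s (f x))
      & (f @: specht lam)%VS = M].

(* The lam-isotypic component: the sum of all the subrepresentations
   isomorphic to [lam]. *)
Definition isotypic (W : vectType R[i]) (act : 'S_n -> W -> W)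
    (lam : seq nat) : set W :=
  [set w : W | exists2 Ms : seq {vspace W},
     (forall M, M \in Ms -> spechtCopy act lam M)
     & w \in (\sum_(M <- Ms) M)%VS].

End SpechtModule.

Section OrthogonalProjection.
Variables (R : realType) (X : finType).

Definition dotp (v w : {ffun X -> R[i]^o}) : R[i] :=
  \sum_(x : X) (v x)^* * w x.

(* Orthogonal projection of w onto a linear subspace U: the unique u in U such
   that w - u is orthogonal to U. *)
Definition orthoproj (U : set {ffun X -> R[i]^o}) (w : {ffun X -> R[i]^o}) :
    {ffun X -> R[i]^o} :=
  xget 0 [set u | U u /\ forall v, U v -> dotp v (w - u) = 0].

End OrthogonalProjection.

Section QuantumFunctional.
Variables (R : realType) (d : 'I_4 -> nat).

(* Multi-indices of the standard basis of V = V_A (x) V_B (x) V_C (x) V_D,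
   where the leg i has dimension d i. *)
Definition legIndex := {dffun forall i : 'I_4, 'I_(d i)}.

Definition tensor4 := {ffun legIndex -> R[i]^o}.

Definition powIndex (n : nat) := {ffun 'I_n -> legIndex}.

Definition tensorPow (n : nat) := {ffun powIndex n -> R[i]^o}.

Definition tpow (psi : tensor4) (n : nat) : tensorPow n :=
  [ffun x : powIndex n => \prod_(t < n) psi (x t)].

Definition permLegs (n : nat) (S : {set 'I_4}) (s : 'S_n) (x : powIndex n) :
    powIndex n :=
  [ffun t => [ffun i : 'I_4 => if i \in S then x (s t) i else x t i]
     : legIndex].

(* 'S_n permutes the n factors V_S and fixes those of the complement of S.  In
   s * t the permutation s is applied first, hence the inverse: this makes
   [legAct S] a left action. *)
Definition legAct (n : nat) (S : {set 'I_4}) (s : 'S_n) (w : tensorPow n) :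
    tensorPow n :=
  [ffun x => w (permLegs S s^-1%g x)].

Definition isoProj (n : nat) (S : {set 'I_4}) (lam : seq nat) :
    tensorPow n -> tensorPow n :=
  orthoproj (isotypic (legAct S) lam).

Definition symProj (n : nat) : tensorPow n -> tensorPow n :=
  orthoproj [set w | forall s : 'S_n, legAct [set: 'I_4] s w = w].

(* The operator attached to the bipartition of the legs into S and its
   complement. *)
Definition bipProj (n : nat) (S : {set 'I_4}) (lam : seq nat) :
    tensorPow n -> tensorPow n :=
  isoProj S lam \o @symProj n.

Definition log2 (x : R) : R := ln x / ln 2.

Definition entropyPart (n : nat) (lam : seq nat) : R :=
  - \sum_(k <- lam) (k%:R / n%:R) * log2 (k%:R / n%:R).

Definition legA : 'I_4 := @Ordinal 4 0 isT.
Definition legB : 'I_4 := @Ordinal 4 1 isT.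
Definition legC : 'I_4 := @Ordinal 4 2 isT.
Definition legD : 'I_4 := @Ordinal 4 3 isT.

(* [tAB] and [tBC] are the weights of AB|CD and BC|AD. *)
Definition upperFunctional (tAB tBC : R) (psi : tensor4) : \bar R :=
  ereal_sup [set e : \bar R | exists (n : nat) (lam mu : seq nat),
    [/\ (1 <= n)%N, is_intpart n lam, is_intpart n mu,
        bipProj [set legA; legB] lam (bipProj [set legB; legC] mu (tpow psi n))
          != 0
      & e = (tAB * entropyPart n lam + tBC * entropyPart n mu)%:E]].

Definition basisTensor (j : legIndex) : tensor4 := [ffun x => (x == j)%:R].

End QuantumFunctional.

(* The unit tensor, the sum over k < r of e_k (x) e_k (x) e_k (x) e_k. *)
Definition unitTensor (R : realType) (r : nat) : tensor4 R (fun=> r) :=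
  \sum_(k < r) basisTensor R ([ffun _ : 'I_4 => k] : legIndex (fun=> r)).

(* Main.v *)
From HB Require Import structures.
Require Import Defs.
From mathcomp Require Import all_boot all_order all_algebra all_fingroup.
From mathcomp Require Import complex ring lra.
From mathcomp Require Import all_classical all_reals all_analysis.
Import Order.TTheory GRing.Theory Num.Theory.
Local Open Scope ring_scope.
Set Implicit Arguments.
Unset Strict Implicit.
Unset Printing Implicit Defensive.

(** The witness has n = 4: the partition (2,1,1) for AB|CD has entropy 3/2 and
    the partition (2,2) for BC|AD has entropy 1, so everything reduces to
      P^{AB}_{(2,1,1)} P^{BC}_{(2,2)} U_2^{(x)4} <> 0.
    The two symmetric projectors act trivially, because U_2^{(x)4} and its image
    under the inner projector are symmetric.

    The inner projector can be computed.  Let c be the Young symmetrizer of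
    shape (2,2) and chi the irreducible character of that shape, seen as an
    element of the group algebra of S_4.  Then chi c = 12 c, and 12 chi is the
    sum of the conjugates of c.  Being central, chi therefore acts as 12 on every
    copy of the Specht module; being real and symmetric, it acts as a
    self-adjoint operator; being a combination of conjugates of c, it sends
    U_2^{(x)4} into the isotypic component, provided that the equivariant maps
    x |-> x h U_2^{(x)4} are injective on the Specht module.  Hence chi/12 gives
    the orthogonal projection ([orthoproj_isotypic]).  Injectivity holds because
    U_2^{(x)4} is the sum over binary words w of the tensors with w on each leg:
    reading the coefficients where A and D carry a word of stabilizer the row
    group shows that a relation x h U_2^{(x)4} = 0 annihilates all sums of x over
    cosets of the row group, so that x c = 0; and x c = 12 x on the left ideal
    generated by c, as c c = 12 c.

    The outer projector need not be computed: it is enough to find one vector v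
    of the (2,1,1)-isotypic component that is not orthogonal to
    u = chi U_2^{(x)4}.  Let w0 be the basis tensor with the word 0011 on A and D
    and the word 0101 on B and C.  On AB it reads 00, 01, 10, 11, four distinct
    letters, so its orbit under permutations of the AB factors is free and spans
    a regular representation.  Applying the Young symmetrizer of shape (2,1,1)
    to w0 thus gives a vector v of the isotypic component.  In every basis
    tensor occurring in u the word on A is the word on D and the word on B is the
    word on C, so among the AB-translates of w0 only w0 itself contributes to
    the overlap of v with u.  The Young symmetrizer has coefficient 1 at the
    identity, and the coefficient of w0 in u is the sum of chi over the
    permutations carrying 0011 to 0101, namely -2 (two 3-cycles and two odd
    permutations). *)

(** * Orthogonal projections in finite-dimensional spaces *)

Section OrthogonalProjections.

Variables (R : realType) (X : finType).
Implicit Types (v w : {ffun X -> R[i]^o}).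

Lemma dotpDr v w1 w2 : dotp v (w1 + w2) = dotp v w1 + dotp v w2.
Proof. by rewrite -big_split; apply: eq_bigr => x _; rewrite ffunE mulrDr. Qed.

Lemma dotpZr v (a : R[i]) w : dotp v (a *: w) = a * dotp v w.
Proof.
by rewrite big_distrr; apply: eq_bigr => x _; rewrite ffunE mulrCA.
Qed.

Lemma dotpNr v w : dotp v (- w) = - dotp v w.
Proof. by rewrite -scaleN1r dotpZr mulN1r. Qed.

Lemma dotpBr v w1 w2 : dotp v (w1 - w2) = dotp v w1 - dotp v w2.
Proof. by rewrite dotpDr dotpNr. Qed.

Lemma dotpC v w : dotp v w = (dotp w v)^*.
Proof.
by rewrite rmorph_sum; apply: eq_bigr => x _; rewrite rmorphM /= conjCK mulrC.
Qed.

Lemma dotpDl v1 v2 w : dotp (v1 + v2) w = dotp v1 w + dotp v2 w.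
Proof. by rewrite dotpC dotpDr rmorphD /= -!dotpC. Qed.

Lemma dotp0l w : dotp 0 w = 0.
Proof. by rewrite /dotp big1 // => x _; rewrite ffunE conjC0 mul0r. Qed.

Lemma dotp0r v : dotp v 0 = 0.
Proof. by rewrite dotpC dotp0l conjC0. Qed.

Lemma dotpZl (a : R[i]) v w : dotp (a *: v) w = a^* * dotp v w.
Proof. by rewrite dotpC dotpZr rmorphM /= -dotpC. Qed.

Lemma dotp_suml (I : Type) (r : seq I) (F : I -> {ffun X -> R[i]^o}) w :
  dotp (\sum_(i <- r) F i) w = \sum_(i <- r) dotp (F i) w.
Proof.
rewrite exchange_big; apply: eq_bigr => x _ /=.
by rewrite sum_ffunE rmorph_sum mulr_suml.
Qed.

Lemma dotp_sumr (I : Type) (r : seq I) v (F : I -> {ffun X -> R[i]^o}) :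
  dotp v (\sum_(i <- r) F i) = \sum_(i <- r) dotp v (F i).
Proof.
rewrite dotpC dotp_suml rmorph_sum; apply: eq_bigr => i _ /=.
by rewrite -dotpC.
Qed.

Lemma dotp_eq0 v : dotp v v = 0 -> v = 0.
Proof.
move=> /eqP; rewrite psumr_eq0 => [/allP v0|x _]; last first.
  by rewrite mulrC mul_conjC_ge0.
apply/ffunP => x; rewrite ffunE; apply/eqP.
by have := v0 x (mem_index_enum x); rewrite mulrC mul_conjC_eq0.
Qed.

(** The difference of two candidate projections lies in U and is orthogonal to
    U, hence to itself. *)
Lemma orthoprojE (U : set {ffun X -> R[i]^o}) w u :
    (forall a b, U a -> U b -> U (a - b)) -> U u ->
    (forall v, U v -> dotp v (w - u) = 0) ->
  orthoproj U w = u.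
Proof.
move=> UB Uu u_orth; rewrite /orthoproj.
case: xgetP => [u' _ [Uu' u'_orth] | /(_ u)[]//].
apply/eqP; rewrite -subr_eq0; apply/eqP/dotp_eq0.
rewrite [X in dotp _ X](_ : _ = w - u - (w - u')); last first.
  by rewrite opprB [RHS]addrC addrA subrK.
by rewrite dotpBr u_orth ?u'_orth ?subrr //; apply: UB.
Qed.

Lemma orthoproj_id (U : set {ffun X -> R[i]^o}) w :
    (forall a b, U a -> U b -> U (a - b)) -> U w ->
  orthoproj U w = w.
Proof.
move=> UB Uw; apply: orthoprojE => // v _.
by rewrite subrr dotp0r.
Qed.

(** Gram-Schmidt, one spanning vector at a time. *)
Lemma ex_orthoproj_span (s : seq {ffun X -> R[i]^o}) w :
  exists2 u, u \in << s >>%VS & forall v, v \in << s >>%VS -> dotp v (w - u) = 0.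
Proof.
elim: s w => [|a s IHs] w.
  exists 0 => [|v]; first exact: mem0v.
  by rewrite span_nil memv0 => /eqP->; rewrite dotp0l.
have [w' w's w'_orth] := IHs w; have [a' a's a'_orth] := IHs a.
pose e := a - a'; pose c := dotp e (w - w') / dotp e e.
have e_as : e \in <<a :: s>>%VS.
  by rewrite span_cons memv_add ?memv_line // rpredN.
have sub_s x : x \in << s >>%VS -> x \in <<a :: s>>%VS.
  by move=> xs; rewrite span_cons -[x]add0r memv_add ?mem0v.
exists (w' + c *: e) => [|v]; first by rewrite memvD ?memvZ ?(sub_s w').
rewrite span_cons => /memv_addP[_ /vlineP[k ->] [x xs ->]].
have -> : k *: a + x = k *: e + (k *: a' + x).
  by rewrite scalerBr addrA subrK.
have y_orth y : y \in << s >>%VS -> dotp y (w - (w' + c *: e)) = 0.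
  move=> ys; rewrite opprD addrA dotpBr dotpZr w'_orth // a'_orth //.
  by rewrite mulr0 subr0.
rewrite dotpDl dotpZl (y_orth (k *: a' + x)) ?memvD ?memvZ // addr0 opprD addrA dotpBr dotpZr.
have [->|e_neq0] := eqVneq e 0; first by rewrite !dotp0l !(mulr0, subr0).
rewrite divfK ?subrr ?mulr0 //.
by apply: contraNneq e_neq0 => /dotp_eq0->.
Qed.

(** A projection that vanishes leaves w orthogonal to U: an overlap with a
    single vector of U shows that it does not, without computing it. *)
Lemma orthoproj_neq0 (U : {vspace {ffun X -> R[i]^o}}) v w :
  v \in U -> dotp v w != 0 -> orthoproj [set` U] w != 0.
Proof.
move=> Uv; apply: contra_neq => proj0.
have [u] := ex_orthoproj_span (vbasis U) w.
rewrite (span_basis (vbasisP U)) => Uu u_orth.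
move: proj0; rewrite (@orthoprojE _ _ u) //; last first.
  by move=> a b /= Ua Ub; apply: memvB.
by move=> u0; have := u_orth _ Uv; rewrite u0 subr0.
Qed.

End OrthogonalProjections.

(** * Modules over the group algebra and isotypic components *)

Section GroupAlgebra.

Variables (R : realType) (n : nat) (W : vectType R[i]).
Variable act : 'S_n -> W -> W.
Hypothesis act_linear : forall s, linear (act s).
Hypothesis actM : forall s t w, act (s * t)%g w = act s (act t w).

Definition algAct (x : groupAlg R n) (w : W) : W := \sum_s x s *: act s w.

Lemma algAct_linearl w : linear (algAct ^~ w).
Proof.
move=> a x y; rewrite /algAct scaler_sumr -big_split; apply: eq_bigr => s _ /=.
by rewrite !ffunE scalerDl scalerA.
Qed.

Lemma algActZl a x w : algAct (a *: x) w = a *: algAct x w.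
Proof.
by rewrite scaler_sumr; apply: eq_bigr => s _; rewrite ffunE scalerA.
Qed.

Lemma actZ s (a : R[i]) w : act s (a *: w) = a *: act s w.
Proof.
have act0 : act s 0 = 0.
  by have := act_linear s (-1) 0 0; rewrite !scaleN1r oppr0 addr0 addNr.
by rewrite -[X in act s X]addr0 act_linear act0 addr0.
Qed.

Lemma act_sum s (I : Type) (r : seq I) (P : pred I) (F : I -> W) :
  act s (\sum_(i <- r | P i) F i) = \sum_(i <- r | P i) act s (F i).
Proof.
apply: (big_morph (act s)) => [u v|]; last by rewrite -(scale0r 0) actZ !scale0r.
by rewrite -[u]scale1r act_linear !scale1r.
Qed.

Lemma algAct_linearr x : linear (algAct x).
Proof.
move=> a u v; rewrite /algAct scaler_sumr -big_split; apply: eq_bigr => s _ /=.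
by rewrite act_linear scalerDr !scalerA mulrC.
Qed.

Lemma algAct_lmul s x w : algAct (lmulAlg s x) w = act s (algAct x w).
Proof.
rewrite act_sum [LHS](reindex_inj (mulgI s)); apply: eq_bigr => g _ /=.
by rewrite ffunE mulKg actZ actM.
Qed.

Definition algActl w : {linear groupAlg R n -> W} :=
  HB.pack (algAct ^~ w) (GRing.isLinear.Build _ _ _ _ _ (algAct_linearl w)).

Definition algActr x : {linear W -> W} :=
  HB.pack (algAct x) (GRing.isLinear.Build _ _ _ _ _ (algAct_linearr x)).

Variable lam : seq nat.

(** The map x |-> x w is equivariant; when it is injective on the Specht module,
    its image is a copy of that module. *)
Lemma isotypic_algAct w x :
    (forall y, y \in specht R n lam -> algAct y w = 0 -> y = 0) ->
    x \in specht R n lam ->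
  isotypic act lam (algAct x w).
Proof.
move=> act_inj xS; pose f := linfun (algActl w).
have fE y : f y = algAct y w by rewrite lfunE.
exists [:: (f @: specht R n lam)%VS]; last by rewrite big_seq1 -fE memv_img.
move=> M; rewrite inE => /eqP->; exists f; split=> // [y z yS zS|s y yS].
  rewrite !fE => /eqP.
  rewrite -subr_eq0 -(linearB (algActl w)) => /eqP /(act_inj _ (memvB yS zS)).
  by move/eqP; rewrite subr_eq0 => /eqP.
by rewrite !fE algAct_lmul.
Qed.

(** Finite dimension: a finite sum of copies of the Specht module of largest
    possible dimension absorbs every other one. *)
Lemma isotypic_vspace : exists U : {vspace W}, isotypic act lam = [set` U]%classic.
Proof.
pose good (Ms : seq {vspace W}) := forall M, M \in Ms -> spechtCopy act lam M.
pose P d := `[< exists2 Ms, good Ms & \dim (\sum_(M <- Ms) M)%VS = d >].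
have exP : exists d, P d.
  by exists 0%N; apply/asboolP; exists [::]; rewrite ?big_nil ?dimv0.
have ubP d : P d -> (d <= \dim {:W})%N.
  by move=> /asboolP[Ms _ <-]; apply: dimvS; apply: subvf.
case: (ex_maxnP exP ubP) => d /asboolP[Ms gMs dimMs] d_max.
exists (\sum_(M <- Ms) M)%VS; apply/seteqP; split=> [w|w wMs]; last by exists Ms.
case=> Ms' gMs' wMs' /=; set U := (\sum_(M <- Ms) M)%VS in dimMs *.
have gMM : good (Ms ++ Ms').
  by move=> M; rewrite mem_cat => /orP[/gMs|/gMs'].
have /d_max : P (\dim (\sum_(M <- Ms ++ Ms') M)%VS) by apply/asboolP; exists (Ms ++ Ms').
rewrite big_cat -/U /= -dimMs => dimUU'.
have /eqP UE : U == (U + \sum_(M <- Ms') M)%VS by rewrite eqEdim addvSl.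
by rewrite UE (subvP (addvSr _ _)).
Qed.

Lemma algAct_act_class (z : groupAlg R n) s w :
    (forall g h, z (g ^ h)%g = z g) ->
  algAct z (act s w) = act s (algAct z w).
Proof.
move=> zJ; rewrite act_sum [LHS](reindex_inj (conjg_inj s^-1%g)).
apply: eq_bigr => g _ /=.
by rewrite zJ actZ -!actM conjgE invgK -!mulgA mulVg mulg1.
Qed.

(** Each conjugate s x s^-1 sends w to the image of s^-1 w under s x, an element
    of the left ideal generated by x.  For x a Young symmetrizer this places the
    action of a sum of conjugates in the isotypic component. *)
Lemma algAct_sum_conjg (x : groupAlg R n) w :
  algAct [ffun g => \sum_s x (g ^ s)%g] w
  = \sum_s algAct (lmulAlg s x) (act s^-1%g w).
Proof.
rewrite [RHS](eq_bigr (fun s => \sum_g x (g ^ s)%g *: act g w)) => [|s _].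
  by rewrite exchange_big; apply: eq_bigr => g _; rewrite ffunE scaler_suml.
rewrite algAct_lmul act_sum [RHS](reindex_inj (conjg_inj s^-1%g)).
by apply: eq_bigr => g _ /=; rewrite conjgKV actZ -!actM conjgE invgK mulgA.
Qed.

End GroupAlgebra.

Lemma algAct_ffunE (R : realType) (n : nat) (X : finType)
    (act : 'S_n -> {ffun X -> R[i]^o} -> {ffun X -> R[i]^o})
    (x : groupAlg R n) w y :
  algAct act x w y = \sum_s x s * act s w y.
Proof. by rewrite sum_ffunE; apply: eq_bigr => s _; rewrite ffunE. Qed.

Section LeftRegular.

Variables (R : realType) (n : nat).

Lemma lmulAlg_linear (s : 'S_n) : linear (@lmulAlg R n s).
Proof. by move=> a x y; apply/ffunP => g; rewrite !ffunE. Qed.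

Lemma lmulAlgM (s t : 'S_n) (x : groupAlg R n) :
  lmulAlg (s * t) x = lmulAlg s (lmulAlg t x).
Proof. by apply/ffunP => g; rewrite !ffunE invMg mulgA. Qed.

Definition algMul : groupAlg R n -> groupAlg R n -> groupAlg R n :=
  algAct (@lmulAlg R n).

Lemma algMulE x y g : algMul x y g = \sum_s x s * y (s^-1 * g)%g.
Proof. by rewrite /algMul algAct_ffunE; apply: eq_bigr => s _; rewrite ffunE. Qed.

End LeftRegular.

(** * Young symmetrizers *)

Section YoungSymmetrizer.

Variables (R : realType) (n : nat) (lam : seq nat).

Local Notation S_lam := (specht R n lam).
Local Notation c_lam := (youngSymmetrizer R n lam).

Lemma lmulAlg_specht s : lmulAlg s c_lam \in S_lam.
Proof. by apply/memv_span/mapP; exists s; rewrite ?mem_enum. Qed.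

Lemma eigen_specht (f : {linear groupAlg R n -> groupAlg R n}) (m : R[i]) x :
    (forall s, f (lmulAlg s c_lam) = m *: lmulAlg s c_lam) -> x \in S_lam ->
  f x = m *: x.
Proof.
move=> fm xS; pose h := (linfun f - m *: \1%VF)%R.
have hE y : h y = f y - m *: y by rewrite !lfun_simp.
suff /subvP/(_ x xS) : (S_lam <= lker h)%VS.
  by rewrite memv_ker hE subr_eq0 => /eqP.
rewrite /specht; apply/span_subvP => _ /mapP[s _ ->].
by rewrite memv_ker hE subr_eq0 fm.
Qed.

Lemma algMul_specht_r (k : R[i]) x :
  algMul c_lam c_lam = k *: c_lam -> x \in S_lam -> algMul x c_lam = k *: x.
Proof.
move=> cc; apply: (@eigen_specht (algActl (@lmulAlg R n) c_lam)) => s.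
rewrite /= (algAct_lmul (@lmulAlg_linear R n) (@lmulAlgM R n)).
by rewrite -/(algMul _ _) cc (actZ (@lmulAlg_linear R n)).
Qed.

Lemma rowGroupV (p : 'S_n) : (p^-1%g \in rowGroup n lam) = (p \in rowGroup n lam).
Proof.
suff sub (s : 'S_n) : s \in rowGroup n lam -> s^-1%g \in rowGroup n lam.
  by apply/idP/idP => [/sub|/sub //]; rewrite invgK.
rewrite !inE => /forallP sR; apply/forallP => t.
by have := sR (s^-1%g t); rewrite permKV eq_sym.
Qed.

(** A cell of the diagram is determined by its row and its column. *)
Lemma row_col_group1 (s : 'S_n) :
  s \in rowGroup n lam -> s \in colGroup n lam -> s = 1%g.
Proof.
rewrite !inE => /forallP s_row /forallP s_col; apply/permP => t.
apply/val_inj; rewrite perm1 /= -(reshape_indexK lam (s t)).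
by rewrite (eqP (s_row t)) (eqP (s_col t)) reshape_indexK.
Qed.

Lemma youngSymmetrizer1 : c_lam 1%g = 1.
Proof.
rewrite ffunE (bigD1 1%g) /=; last by rewrite inE; apply/forallP => t; rewrite perm1.
rewrite (big_pred1 1%g) => [|q]; last first.
  rewrite mul1g [RHS]/= andb_idl // => /eqP ->.
  by rewrite inE; apply/forallP => t; rewrite perm1.
rewrite odd_perm1 expr0 big1 ?addr0 // => p /andP[p_row p_neq1].
rewrite big1 // => q /andP[q_col /eqP pq1]; case/eqP: p_neq1.
have pE : p = q^-1%g by apply: (mulIg q); rewrite pq1 mulVg.
by rewrite pE (row_col_group1 _ q_col) ?invg1 // -rowGroupV -pE.
Qed.

(** The sums of x over the left cosets of the row group determine x c_lam,
    because c_lam is a sum over the row group times a sum over the column group;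
    and x c_lam is a nonzero multiple of x. *)
Lemma specht_row_sums (k : R[i]) x :
    algMul c_lam c_lam = k *: c_lam -> k != 0 -> x \in S_lam ->
    (forall g, \sum_(p in rowGroup n lam) x (g * p)%g = 0) ->
  x = 0.
Proof.
move=> cc k_neq0 xS x_row; apply/eqP.
suff : k *: x == 0 by rewrite scaler_eq0 (negPf k_neq0).
rewrite -(algMul_specht_r cc xS); apply/eqP/ffunP => g; rewrite algMulE ffunE.
transitivity (\sum_(q in colGroup n lam) (-1) ^+ odd_perm q *
    \sum_(p in rowGroup n lam) x (g * q^-1 * p^-1)%g : R[i]).
  (* For each p and q, the only s with p q = s^-1 g is g q^-1 p^-1. *)
  under eq_bigr do rewrite ffunE big_distrr.
  rewrite exchange_big /=; under [RHS]eq_bigr do rewrite big_distrr.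
  rewrite [RHS]exchange_big; apply: eq_bigr => p _ /=.
  under eq_bigr do rewrite big_distrr big_mkcondr.
  rewrite exchange_big; apply: eq_bigr => q _ /=.
  rewrite (bigD1 (g * q^-1 * p^-1)%g) //= !invMg !invgK mulgA mulgKV eqxx.
  rewrite big1 ?addr0 1?mulrC // => s s_neq; rewrite ifN //.
  apply: contra_neqN s_neq => /eqP pq.
  by rewrite -mulgA -invMg pq invMg invgK mulKVg.
rewrite big1 // => q _; rewrite (reindex_inj invg_inj) /=.
rewrite (eq_bigl _ _ rowGroupV).
by under eq_bigr do rewrite invgK; rewrite x_row mulr0.
Qed.

End YoungSymmetrizer.

(** * Isotypic projection by a central element *)

Section IsotypicProjection.

Variables (R : realType) (n : nat) (lam : seq nat).

Local Notation S_lam := (specht R n lam).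
Local Notation c_lam := (youngSymmetrizer R n lam).

Variables (z : groupAlg R n) (m : R[i]).
Hypothesis z_class : forall g h, z (g ^ h)%g = z g.
Hypothesis z_c : algMul z c_lam = m *: c_lam.

Lemma algMul_central x : x \in S_lam -> algMul z x = m *: x.
Proof.
apply: (@eigen_specht _ _ _ (algActr (@lmulAlg_linear R n) z)) => s.
rewrite /= (algAct_act_class (@lmulAlg_linear R n) (@lmulAlgM R n)) //.
by rewrite -/(algMul _ _) z_c (actZ (@lmulAlg_linear R n)).
Qed.

(** An equivariant map from the Specht module carries left multiplication by z
    to the action of z, so z acts as the scalar m on every copy. *)
Lemma isotypic_central (W : vectType R[i]) (act : 'S_n -> W -> W) w :
    (forall s, linear (act s)) -> isotypic act lam w ->
  algAct act z w = m *: w.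
Proof.
move=> act_linear [Ms copyMs wMs].
pose h := (linfun (algActr act_linear z) - m *: \1%VF)%R.
have hE y : h y = algAct act z y - m *: y by rewrite !lfun_simp.
suff sMh : (\sum_(M <- Ms) M <= lker h)%VS.
  by have := subvP sMh _ wMs; rewrite memv_ker hE subr_eq0 => /eqP.
rewrite big_seq; elim/big_ind: _ => [|U V|M /copyMs[f [_ f_act <-]]].
- exact: sub0v.
- by rewrite subv_add => -> ->.
apply/subvP => _ /memv_imgP[x xS ->]; rewrite memv_ker hE subr_eq0.
rewrite -linearZ -algMul_central // linear_sum; apply/eqP/eq_bigr => s _ /=.
by rewrite linearZ /= f_act.
Qed.

Variable X : finType.
Local Notation W := {ffun X -> R[i]^o}.

Variable act : 'S_n -> W -> W.
Hypothesis act_linear : forall s, linear (act s).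
Hypothesis act1 : forall w, act 1%g w = w.
Hypothesis actM : forall s t w, act (s * t)%g w = act s (act t w).
Hypothesis act_unitary : forall s v w, dotp (act s v) (act s w) = dotp v w.

Hypothesis z_real : forall g, (z g)^* = z g.
Hypothesis zV : forall g, z g^-1%g = z g.

Lemma dotp_algActl v w : dotp (algAct act z v) w = dotp v (algAct act z w).
Proof.
rewrite /algAct dotp_suml dotp_sumr [RHS](reindex_inj invg_inj).
apply: eq_bigr => s _ /=; rewrite dotpZl dotpZr zV z_real; congr (_ * _).
by rewrite -(act_unitary s^-1%g) -actM mulVg act1.
Qed.

Variable k : R[i].
Hypothesis sum_conjg_c : [ffun g => \sum_s c_lam (g ^ s)%g] = k *: z.
Hypothesis k_neq0 : k != 0.
Hypothesis m_neq0 : m != 0.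
Hypothesis m_real : m^* = m.

(** The operator z / m is the identity on the isotypic component and is
    self-adjoint, so w - (z / m) w is orthogonal to that component.  Since z is a
    combination of conjugates of the Young symmetrizer, (z / m) w lies in the
    component as soon as the maps x |-> x (s w) embed the Specht module. *)
Lemma orthoproj_isotypic w :
    (forall s x, x \in S_lam -> algAct act x (act s w) = 0 -> x = 0) ->
  orthoproj (isotypic act lam) w = m^-1 *: algAct act z w.
Proof.
move=> w_inj; have [U isoU] := isotypic_vspace act lam.
apply: orthoprojE.
- by rewrite isoU => a b /= aU bU; apply: memvB.
- have -> : z = k^-1 *: [ffun g => \sum_s c_lam (g ^ s)%g].
    by rewrite sum_conjg_c scalerK.
  rewrite algActZl algAct_sum_conjg // isoU /=.
  do 2![apply: memvZ]; apply: memv_suml => s _.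
  have : isotypic act lam (algAct act (lmulAlg s c_lam) (act s^-1%g w)).
    apply: isotypic_algAct => //; first exact: w_inj.
    exact: lmulAlg_specht.
  by rewrite isoU.
move=> v vI; apply/eqP; rewrite dotpBr dotpZr -dotp_algActl.
by rewrite (isotypic_central _ vI) // dotpZl subr_eq0 m_real mulKf.
Qed.

End IsotypicProjection.

(** * Permutations of four points as lists *)

Section Codes.

(** The list of values of s.  On such lists products, inverses and signs are
    computed by evaluation, which turns identities in the group algebra of 'S_4
    into finite checks. *)
Definition code (s : 'S_4) : seq nat := [seq val (s i) | i <- enum 'I_4].

Definition comp_code (a b : seq nat) : seq nat := [seq nth 0%N b i | i <- a].

Definition inv_code (a : seq nat) : seq nat := [seq index i a | i <- iota 0 4].

Definition all_codes : seq (seq nat) := permutations (iota 0 4).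

Lemma size_code s : size (code s) = 4.
Proof. by rewrite size_map size_enum_ord. Qed.

Lemma nth_code s (i : 'I_4) : nth 0%N (code s) i = s i.
Proof. by rewrite (nth_map i) ?size_enum_ord // nth_ord_enum. Qed.

Lemma code_inj : injective code.
Proof.
by move=> s t st; apply/permP => i; apply/val_inj; rewrite /= -!nth_code st.
Qed.

Lemma codeM s t : code (s * t)%g = comp_code (code s) (code t).
Proof.
rewrite /comp_code {1 3}/code -map_comp; apply: eq_map => i /=.
by rewrite permM nth_code.
Qed.

Lemma code1 : code 1%g = iota 0 4.
Proof. by rewrite -(val_enum_ord 4); apply: eq_map => i; rewrite perm1. Qed.

Lemma uniq_code s : uniq (code s).
Proof.
by rewrite map_inj_uniq ?enum_uniq // => i j /val_inj /perm_inj.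
Qed.

Lemma codeV s : code s^-1%g = inv_code (code s).
Proof.
rewrite /inv_code -(val_enum_ord 4) -map_comp; apply: eq_map => i /=.
rewrite -[in RHS](permKV s i) -(nth_code s) index_uniq ?size_code ?uniq_code //.
Qed.

Lemma mem_code s : code s \in all_codes.
Proof.
have sub : {subset code s <= iota 0 4}.
  by move=> _ /mapP[i _ ->]; rewrite mem_iota ltn_ord.
rewrite mem_permutations uniq_perm ?uniq_code ?iota_uniq //.
by have [] := uniq_min_size (uniq_code s) sub; rewrite ?size_code.
Qed.

Lemma perm_codes : perm_eq [seq code s | s : 'S_4] all_codes.
Proof.
have u : uniq [seq code s | s : 'S_4] by rewrite map_inj_uniq ?enum_uniq //; apply: code_inj.
have sub : {subset [seq code s | s : 'S_4] <= all_codes}.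
  by move=> _ /mapP[s _ ->]; apply: mem_code.
have le_size : (size all_codes <= size [seq code s | s : 'S_4])%N.
  by rewrite size_map -cardE card_Sn.
by apply: uniq_perm => //; have [] := uniq_min_size u sub le_size.
Qed.

Lemma sum_codes (V : nmodType) (F : seq nat -> V) :
  \sum_(s : 'S_4) F (code s) = \sum_(a <- all_codes) F a.
Proof. by rewrite -(perm_big _ perm_codes) big_map enumT. Qed.

(** The parity of the number of inversions. *)
Definition odd_code (a : seq nat) : bool :=
  odd (count (fun ij => nth 0 a ij.2 < nth 0 a ij.1)%N
    [:: (0, 1); (0, 2); (0, 3); (1, 2); (1, 3); (2, 3)]%N).

(** Inversion parity is multiplicative and is odd on transpositions, which
    generate. *)
Lemma odd_perm_code s : odd_perm s = odd_code (code s).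
Proof.
have odd_codeM a b : a \in all_codes -> b \in all_codes ->
    odd_code (comp_code a b) = odd_code a (+) odd_code b.
  have : all (fun a => all (fun b => odd_code (comp_code a b) ==
            odd_code a (+) odd_code b) all_codes) all_codes.
    by vm_compute.
  by move=> /allP H /H /allP H' /H' /eqP.
have odd_tperm_code (i j : 'I_4) : i != j -> odd_code (code (tperm i j)).
  pose tperm_code (i j : nat) := [seq (if k == i then j else
    if k == j then i else k) | k <- iota 0 4].
  have -> : code (tperm i j) = tperm_code i j.
    rewrite /tperm_code -(val_enum_ord 4) -map_comp; apply: eq_map => k /=.
    rewrite !val_eqE; case: tpermP => [->|->|/eqP/negPf-> /eqP/negPf->] //.
      by rewrite eqxx.
    by rewrite eqxx; case: eqP => [->|].
  have : all (fun i => all (fun j => (i != j) ==> odd_code (tperm_code i j))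
      (iota 0 4)) (iota 0 4) by vm_compute.
  by move=> /allP/(_ i); rewrite mem_iota ltn_ord => /(_ isT) /allP/(_ j);
     rewrite mem_iota ltn_ord => /(_ isT) /implyP.
have [ts -> {s}] := prod_tpermP s.
elim: ts => [_|[i j] ts IHts /= /andP[ij ts_ij]].
  by rewrite big_nil odd_perm1 code1.
rewrite big_cons odd_permM odd_tperm IHts // codeM odd_codeM ?mem_code //.
by rewrite odd_tperm_code // ij.
Qed.

End Codes.

(** * The shape (2,2): Young symmetrizer and character *)

Section ShapeTwoTwo.

Variable R : realType.

Local Notation lam22 := [:: 2; 2]%N.
Local Notation c22 := (youngSymmetrizer R 4 lam22).

Definition sum_int (F : seq nat -> int) (r : seq (seq nat)) : int :=
  foldr (fun a x => F a + x) 0 r.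

Lemma sum_intE F r : (sum_int F r)%:~R = \sum_(a <- r) (F a)%:~R :> R[i].
Proof. by elim: r => [|a r IHr]; rewrite ?big_nil ?big_cons //= intrD IHr. Qed.

Definition matching_codes (e f : nat -> nat) : seq (seq nat) :=
  [seq a <- all_codes | all (fun t => e (nth 0%N a t) == f t) (iota 0 4)].

Lemma sum_matching_codes (e f : nat -> nat) (F : seq nat -> R[i]) :
  \sum_(s : 'S_4 | [forall t, e (s t) == f t]) F (code s)
  = \sum_(a <- matching_codes e f) F a.
Proof.
rewrite big_filter [RHS]big_mkcond -sum_codes [LHS]big_mkcond.
apply: eq_bigr => s _; congr (if _ then _ else _).
apply/forallP/allP => sf t; last by rewrite -nth_code sf // mem_iota ltn_ord.
rewrite mem_iota => t_lt4; rewrite (nth_code s (Ordinal t_lt4)).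
exact: (sf (Ordinal t_lt4)).
Qed.

Definition row_codes := matching_codes (reshape_index lam22) (reshape_index lam22).

Definition col_codes := matching_codes (reshape_offset lam22) (reshape_offset lam22).

Lemma sum_row_codes (F : seq nat -> R[i]) :
  \sum_(p in rowGroup 4 lam22) F (code p) = \sum_(a <- row_codes) F a.
Proof. by rewrite -sum_matching_codes; apply: eq_bigl => p; rewrite inE. Qed.

Lemma sum_col_codes (F : seq nat -> R[i]) :
  \sum_(p in colGroup 4 lam22) F (code p) = \sum_(a <- col_codes) F a.
Proof. by rewrite -sum_matching_codes; apply: eq_bigl => p; rewrite inE. Qed.

Definition young_int (a : seq nat) : int :=
  sum_int (fun p => sum_int (fun q =>
    if comp_code p q == a then (if odd_code q then -1 else 1) else 0)
    col_codes) row_codes.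

Lemma youngE g : c22 g = (young_int (code g))%:~R.
Proof.
rewrite ffunE sum_intE -sum_row_codes; apply: eq_bigr => p _.
rewrite sum_intE -sum_col_codes big_mkcondr; apply: eq_bigr => q _.
rewrite -odd_perm_code -codeM (inj_eq code_inj).
by case: ifP => // _; case: odd_perm; rewrite ?expr0 ?expr1 ?mulrN1z.
Qed.

(** The irreducible character of the partition (2,2): it is lifted from the
    degree 2 character of 'S_3 along the quotient by the Klein four-group,
    which consists of the even elements of square 1. *)
Definition chi22 : groupAlg R 4 :=
  [ffun g => if odd_perm g then 0 else if (g * g == 1)%g then 2 else -1].

Definition chi_int (a : seq nat) : int :=
  if odd_code a then 0 else if comp_code a a == iota 0 4 then 2 else -1.

Lemma chi22E g : chi22 g = (chi_int (code g))%:~R.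
Proof.
rewrite ffunE /chi_int -odd_perm_code -codeM -code1 (inj_eq code_inj).
by do 2![case: ifP => // _].
Qed.

Lemma chi22_class g h : chi22 (g ^ h)%g = chi22 g.
Proof. by rewrite !ffunE odd_permJ -conjMg conjg_eq1. Qed.

Lemma chi22V g : chi22 g^-1%g = chi22 g.
Proof. by rewrite !ffunE odd_permV -invMg eq_invg1. Qed.

Lemma chi22_real g : (chi22 g)^* = chi22 g.
Proof. by rewrite chi22E rmorph_int. Qed.

Lemma algMul_int (x y : groupAlg R 4) (F G : seq nat -> int) g :
    (forall h, x h = (F (code h))%:~R) -> (forall h, y h = (G (code h))%:~R) ->
  algMul x y g = (sum_int (fun a => F a * G (comp_code (inv_code a) (code g)))
    all_codes)%:~R.
Proof.
move=> xF yG; rewrite algMulE sum_intE -sum_codes; apply: eq_bigr => s _.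
by rewrite intrM -codeV -codeM xF yG.
Qed.

(** The scalar 12 is 4! divided by the dimension 2 of the Specht module, here
    and in the next two lemmas. *)
Lemma c22_idem : algMul c22 c22 = 12 *: c22.
Proof.
apply/ffunP => g; rewrite (algMul_int _ youngE youngE) ffunE youngE.
have : all (fun b => sum_int (fun a => young_int a *
  young_int (comp_code (inv_code a) b)) all_codes == 12 * young_int b) all_codes.
  by vm_compute.
by move=> /allP/(_ _ (mem_code g))/eqP->; rewrite intrM.
Qed.

Lemma chi22_c22 : algMul chi22 c22 = 12 *: c22.
Proof.
apply/ffunP => g; rewrite (algMul_int _ chi22E youngE) ffunE youngE.
have : all (fun b => sum_int (fun a => chi_int a *
  young_int (comp_code (inv_code a) b)) all_codes == 12 * young_int b) all_codes.
  by vm_compute.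
by move=> /allP/(_ _ (mem_code g))/eqP->; rewrite intrM.
Qed.

(** The sum of the conjugates of c22 is central and lies in the two-sided ideal
    of the shape (2,2), so it is a multiple of chi22; the factor is read off at
    the identity, where the values are 24 and 2. *)
Lemma sum_conjg_c22 : [ffun g => \sum_s c22 (g ^ s)%g] = 12 *: chi22.
Proof.
apply/ffunP => g; rewrite [LHS]ffunE [RHS]ffunE chi22E.
transitivity ((sum_int (fun a => young_int
    (comp_code (inv_code a) (comp_code (code g) a))) all_codes)%:~R : R[i]).
  rewrite sum_intE -sum_codes; apply: eq_bigr => s _.
  by rewrite -codeV -!codeM youngE.
have : all (fun b => sum_int (fun a => young_int
    (comp_code (inv_code a) (comp_code b a))) all_codes == 12 * chi_int b) all_codes.
  by vm_compute.
by move=> /allP/(_ _ (mem_code g))/eqP->; rewrite intrM.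
Qed.

(** The index of the row and that of the column of the cells 0, 1, 2, 3 spell
    the words 0011 and 0101.  Of the four permutations h carrying the first to
    the second, two are 3-cycles and two are odd. *)
Lemma chi22_row_to_col :
  \sum_(h : 'S_4 | [forall t : 'I_4,
      reshape_index lam22 (h t) == reshape_offset lam22 t]) chi22 h = -2.
Proof.
under eq_bigr do rewrite chi22E.
rewrite (sum_matching_codes _ _ (fun a => (chi_int a)%:~R)) -sum_intE.
suff -> : sum_int chi_int (matching_codes (reshape_index lam22)
  (reshape_offset lam22)) = - 2 by rewrite mulrNz.
by vm_compute.
Qed.

End ShapeTwoTwo.

(** * Permuting the legs of a tensor power *)

Section LegActions.

Variables (R : realType) (d : 'I_4 -> nat) (n : nat).
Implicit Types (S : {set 'I_4}) (s t : 'S_n) (v w : tensorPow R d n).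

Lemma permLegsM S s t (x : powIndex d n) :
  permLegs S s (permLegs S t x) = permLegs S (s * t)%g x.
Proof.
apply/ffunP => i; apply/ffunP => j; rewrite !ffunE.
by case: ifP => // jS; rewrite ?permM ?ffunE ?jS.
Qed.

Lemma permLegs1 S (x : powIndex d n) : permLegs S 1%g x = x.
Proof.
by apply/ffunP => i; apply/ffunP => j; rewrite !ffunE perm1; case: ifP.
Qed.

Lemma legAct_linear S s : linear (@legAct R d n S s).
Proof. by move=> a v w; apply/ffunP => x; rewrite !ffunE. Qed.

Lemma legAct1 S w : legAct S 1%g w = w.
Proof. by apply/ffunP => x; rewrite ffunE invg1 permLegs1. Qed.

Lemma legActM S s t w : legAct S (s * t)%g w = legAct S s (legAct S t w).
Proof. by apply/ffunP => x; rewrite !ffunE invMg permLegsM. Qed.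

Lemma legAct_unitary S s v w : dotp (legAct S s v) (legAct S s w) = dotp v w.
Proof.
have permLegs_inj : injective (@permLegs d n S s^-1%g).
  by apply: (can_inj (g := permLegs S s)) => x; rewrite permLegsM mulgV permLegs1.
by rewrite [RHS](reindex_inj permLegs_inj); apply: eq_bigr => x _; rewrite !ffunE.
Qed.

(** Permuting all the legs by s conjugates the permutations of the legs in S by
    s, so an element of the group algebra that is constant on conjugacy classes
    preserves symmetric tensors. *)
Lemma legActT_legAct S s t w :
  legAct [set: 'I_4] s (legAct S t w)
  = legAct S (t ^ s^-1)%g (legAct [set: 'I_4] s w).
Proof.
apply/ffunP => x; rewrite !ffunE; congr (w _).
apply/ffunP => i; apply/ffunP => j; rewrite !ffunE finset.in_setT.
case: ifP => // jS; rewrite -!permM; congr (x _ j).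
by congr ((_ : 'S_n) i); rewrite conjgE !invMg !invgK -!mulgA mulKg.
Qed.

Lemma legActT_tpow (psi : tensor4 R d) s :
  legAct [set: 'I_4] s (tpow psi n) = tpow psi n.
Proof.
apply/ffunP => x; rewrite !ffunE [RHS](reindex_inj (@perm_inj _ s^-1%g)).
apply: eq_bigr => i _; congr (psi _); apply/ffunP => j.
by rewrite !ffunE finset.in_setT.
Qed.

Lemma symProj_id w :
  (forall s, legAct [set: 'I_4] s w = w) -> symProj w = w.
Proof.
move=> sym_w; apply: orthoproj_id => // a b sym_a sym_b s.
by apply/ffunP => x; rewrite !ffunE -[a in RHS](sym_a s) -[b in RHS](sym_b s) !ffunE.
Qed.

Lemma bipProjE S lam w :
  (forall s, legAct [set: 'I_4] s w = w) -> bipProj S lam w = isoProj S lam w.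
Proof. by move=> sym_w; rewrite /bipProj /= symProj_id. Qed.

End LegActions.

(** * Powers of the unit tensor *)

Section UnitTensorPower.

Variables (R : realType) (n r : nat).
Implicit Types (x : powIndex (fun=> r) n) (a b : 'I_n -> 'I_r).

Lemma tpow_unitE x :
  tpow (unitTensor R r) n x = [forall t, forall i, x t i == x t legA]%:R.
Proof.
rewrite ffunE; have unitE (y : legIndex (fun=> r)) :
    unitTensor R r y = [forall i, y i == y legA]%:R.
  rewrite sum_ffunE (bigD1 (y legA)) //= big1 ?addr0 => [|k k_neq].
    rewrite ffunE; congr ((nat_of_bool _)%:R); apply/eqP/forallP => [-> i|y_cst].
      by rewrite !ffunE.
    by apply/ffunP => i; rewrite ffunE (eqP (y_cst i)).
  rewrite ffunE (negPf (_ : y != _)) //; apply: contraNneq k_neq => ->.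
  by rewrite ffunE.
under eq_bigr do rewrite unitE.
case: forallP => [x_cst|x_ncst]; first by rewrite big1 // => t _; rewrite x_cst.
have /existsP[t tx] : [exists t, ~~ [forall i, x t i == x t legA]].
  by rewrite -negb_forall; apply/forallP.
by rewrite (bigD1 t) //= (negPf tx) mul0r.
Qed.

Local Notation BC := ([set legB; legC] : {set 'I_4}).

(** Permuting the BC factors of the n-th power of the unit tensor, which is the
    sum over words w of the tensors with w on each leg, only produces basis
    tensors of this form. *)
Definition wordIndex a b : powIndex (fun=> r) n :=
  [ffun t => [ffun i => if i \in BC then b t else a t]
     : legIndex (fun=> r)].

Lemma legAct_unit_support (h : 'S_n) x :
    legAct BC h (tpow (unitTensor R r) n) x != 0 ->
  forall t, x t legA = x t legD /\ x t legB = x t legC.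
Proof.
rewrite ffunE tpow_unitE; case: forallP => [x_cst _ t|_]; last by rewrite eqxx.
split.
  by have /forallP/(_ legD)/eqP := x_cst t; rewrite !ffunE !inE /=.
have /forallP x_ht := x_cst (h t).
have /eqP := x_ht legB; have /eqP <- := x_ht legC.
by rewrite !ffunE !inE /= permK.
Qed.

Lemma legAct_unit_word (h : 'S_n) a b :
  legAct BC h (tpow (unitTensor R r) n) (wordIndex a b)
  = [forall t, a (h t) == b t]%:R.
Proof.
rewrite ffunE tpow_unitE; congr ((nat_of_bool _)%:R); apply/forallP/forallP => ab t.
  have /forallP/(_ legB) := ab (h t).
  by rewrite !ffunE !inE /= permK eq_sym.
apply/forallP => i; rewrite !ffunE !inE /=.
case: (_ || _); rewrite ?eqxx //.
by rewrite -(eqP (ab (h^-1%g t))) permKV.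
Qed.

End UnitTensorPower.

(** * The overlap of the two projections *)

Section Overlap.

Variable R : realType.

Local Notation lam22 := [:: 2; 2]%N.
Local Notation lam211 := [:: 2; 1; 1]%N.
Local Notation AB := ([set legA; legB] : {set 'I_4}).
Local Notation BC := ([set legB; legC] : {set 'I_4}).
Local Notation psi4 := (tpow (unitTensor R 2) 4).

Definition rowLetter (t : 'I_4) : 'I_2 := inord (reshape_index lam22 t).
Definition colLetter (t : 'I_4) : 'I_2 := inord (reshape_offset lam22 t).

Lemma rowLetterE t : rowLetter t = reshape_index lam22 t :> nat.
Proof. by rewrite inordK //; case: t => [[|[|[|[|]]]]]. Qed.

Lemma colLetterE t : colLetter t = reshape_offset lam22 t :> nat.
Proof. by rewrite inordK //; case: t => [[|[|[|[|]]]]]. Qed.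

Lemma letters_inj t t' :
  rowLetter t = rowLetter t' -> colLetter t = colLetter t' -> t = t'.
Proof.
move=> /(congr1 val) + /(congr1 val); rewrite /= !rowLetterE !colLetterE.
move=> rowE colE; apply/val_inj.
by rewrite /= -(reshape_indexK lam22 t) rowE colE reshape_indexK.
Qed.

(** The coefficients of x h U_2^{(x)4} at suitable multi-indices are the sums of
    x over the left cosets of the row group. *)
Lemma legAct_unit_inj (h : 'S_4) (x : groupAlg R 4) :
    x \in specht R 4 lam22 ->
    algAct (legAct BC) x (legAct BC h psi4) = 0 ->
  x = 0.
Proof.
move=> xS /ffunP x_psi0; apply: (specht_row_sums (c22_idem R)) => // g.
(* The word of the row indices, moved by h^-1, undoes h on the legs A and D; its
   stabilizer is then the row group, and g selects the coset. *)
have := x_psi0 (wordIndex (rowLetter \o h^-1%g) (rowLetter \o g)).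
rewrite algAct_ffunE [RHS]ffunE => S0; apply: etrans S0; rewrite [RHS](reindex_inj (mulgI g)).
rewrite big_mkcond; apply: eq_bigr => p _; rewrite -legActM legAct_unit_word.
rewrite inE /=; case: forallP => p_row; case: forallP => gp_row.
- by rewrite mulr1.
- case: gp_row => t; rewrite -val_eqE /= !permM permK !rowLetterE.
  exact: p_row.
- case: p_row => t; have := gp_row (g^-1%g t).
  by rewrite -val_eqE /= !permM permK permKV !rowLetterE.
- by rewrite mulr0.
Qed.

Definition chi_psi : tensorPow R (fun=> 2%N) 4 :=
  algAct (legAct BC) (chi22 R) psi4.

Lemma isoProj22_unit : isoProj BC lam22 psi4 = 12^-1 *: chi_psi.
Proof.
apply: (orthoproj_isotypic (@chi22_class R) (chi22_c22 R) _ _ _ _ _ _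
  (sum_conjg_c22 R)).
- exact: legAct_linear.
- exact: legAct1.
- exact: legActM.
- exact: legAct_unitary.
- exact: chi22_real.
- exact: chi22V.
- by rewrite pnatr_eq0.
- by rewrite pnatr_eq0.
- by rewrite rmorph_nat.
- exact: legAct_unit_inj.
Qed.

Lemma chi_psi_sym (s : 'S_4) : legAct [set: 'I_4] s chi_psi = chi_psi.
Proof.
rewrite (act_sum (@legAct_linear R _ _ _)) [RHS](reindex_inj (conjg_inj s^-1%g)).
apply: eq_bigr => g _; rewrite (actZ (@legAct_linear R _ _ _)).
by rewrite legActT_legAct legActT_tpow chi22_class.
Qed.

Local Notation w0 := (wordIndex rowLetter colLetter).

Definition delta_w0 : tensorPow R (fun=> 2%N) 4 := [ffun x => (x == w0)%:R].

Lemma legAct_delta_w0 (S : {set 'I_4}) (g : 'S_4) x :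
  legAct S g delta_w0 x = (x == permLegs S g w0)%:R.
Proof.
rewrite !ffunE; congr ((nat_of_bool _)%:R); apply/eqP/eqP => [<-|->];
  by rewrite permLegsM ?mulgV ?mulVg permLegs1.
Qed.

Lemma legAct_delta_w0_permLegs (S : {set 'I_4}) (g : 'S_4) :
  legAct S g delta_w0 (permLegs S g w0) = 1.
Proof. by rewrite legAct_delta_w0 eqxx. Qed.

(** On the legs A and B, w0 carries the row and column indices of the four cells,
    so its four AB-letters are distinct. *)
Lemma permLegs_w0_inj (g h : 'S_4) :
  permLegs AB g w0 = permLegs AB h w0 -> g = h.
Proof.
move=> /ffunP gh; apply/permP => t; have /ffunP gh_t := gh t.
apply: letters_inj; [have := gh_t legA | have := gh_t legB];
  by rewrite !ffunE !inE /=.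
Qed.

(** The AB-orbit of w0 is free, so x |-> x w0 is injective on the whole group
    algebra, and in particular on the Specht module. *)
Lemma isotypic211_delta_w0 :
  isotypic (legAct AB) lam211
    (algAct (legAct AB) (youngSymmetrizer R 4 lam211) delta_w0).
Proof.
apply: (isotypic_algAct (@legAct_linear R _ _ AB) (@legActM R _ _ AB))
  => [y _ /ffunP y_w0|].
- apply/ffunP => g; have := y_w0 (permLegs AB g w0).
  rewrite algAct_ffunE (bigD1 g) //= legAct_delta_w0_permLegs mulr1.
  rewrite big1 ?addr0 => [->|h h_neq]; first by rewrite !ffunE.
  rewrite legAct_delta_w0.
  by case: eqP => [/permLegs_w0_inj gh|_]; [rewrite gh eqxx in h_neq | rewrite mulr0].
- have <- : lmulAlg 1%g (youngSymmetrizer R 4 lam211) = youngSymmetrizer R 4 lam211.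
    by apply/ffunP => g; rewrite ffunE invg1 mul1g.
  exact: lmulAlg_specht.
Qed.

Lemma chi_psi_w0 : chi_psi w0 = -2.
Proof.
rewrite -(chi22_row_to_col R) algAct_ffunE [RHS]big_mkcond; apply: eq_bigr => h _.
rewrite legAct_unit_word; under eq_forallb do rewrite -val_eqE /= rowLetterE colLetterE.
by case: ifP => _; rewrite ?mulr1 ?mulr0.
Qed.

(** Every basis tensor occurring in chi_psi agrees on A and D, and on B and C;
    an AB-translate of w0 by g does so only if g fixes both words. *)
Lemma chi_psi_permLegs_w0 (g : 'S_4) : g != 1%g -> chi_psi (permLegs AB g w0) = 0.
Proof.
move=> g_neq1; rewrite algAct_ffunE big1 // => h _.
have [->|/legAct_unit_support supp] := eqVneq (legAct BC h psi4 (permLegs AB g w0)) 0.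
  by rewrite mulr0.
case/eqP: g_neq1; apply/permP => t; rewrite perm1.
by apply: letters_inj; have [] := supp t; rewrite !ffunE !inE /=.
Qed.

Lemma overlap_neq0 :
  bipProj AB lam211 (bipProj BC lam22 psi4) != 0.
Proof.
rewrite [bipProj BC _ _]bipProjE; last exact: legActT_tpow.
rewrite isoProj22_unit bipProjE => [|s]; last first.
  by rewrite (actZ (@legAct_linear R _ _ _)) chi_psi_sym.
rewrite /isoProj; have [U isoU] := isotypic_vspace (@legAct R (fun=> 2%N) 4 AB) lam211.
have := isotypic211_delta_w0; rewrite isoU => /= vU.
apply: (orthoproj_neq0 vU); rewrite dotpZr dotp_suml.
have coef g : dotp (youngSymmetrizer R 4 lam211 g *: legAct AB g delta_w0) chi_psi
    = (youngSymmetrizer R 4 lam211 g)^* * chi_psi (permLegs AB g w0).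
  rewrite dotpZl /dotp (bigD1 (permLegs AB g w0)) //= legAct_delta_w0_permLegs.
  rewrite conjC1 mul1r big1 ?addr0 // => x x_neq.
  by rewrite legAct_delta_w0 (negPf x_neq) conjC0 mul0r.
under eq_bigr do rewrite coef.
rewrite (bigD1 1%g) //= permLegs1 chi_psi_w0 youngSymmetrizer1 conjC1 mul1r.
rewrite big1 ?addr0 => [|g g_neq1]; last by rewrite chi_psi_permLegs_w0 ?mulr0.
by rewrite mulf_neq0 ?invr_neq0 ?oppr_eq0 ?pnatr_eq0.
Qed.

End Overlap.

Theorem claimD3 (R : realType) (tAB tBC : R)
    (tAB_gt0 : 0 < tAB) (tAB_lt1 : tAB < 1) (tBC_def : tBC = 1 - tAB) :
  ((3 / 2 * tAB + tBC)%:E <= upperFunctional tAB tBC (unitTensor R 2))%E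
  /\ 1 < 3 / 2 * tAB + tBC.
Proof.
split; last by rewrite tBC_def; lra.
apply: ereal_sup_ubound; exists 4%N, [:: 2; 1; 1]%N, [:: 2; 2]%N.
split=> //; first exact: overlap_neq0.
have ln2_neq0 : ln 2 != 0 :> R by rewrite gt_eqF // ln_gt0 ?ltr1n.
have log2_half : log2 (2%:R / 4%:R) = -1 :> R.
  have -> : 2%:R / 4%:R = 2^-1 :> R by field.
  by rewrite /log2 lnV ?posrE // mulNr divff.
have log2_quarter : log2 (1%:R / 4%:R) = -2 :> R.
  have -> : 1%:R / 4%:R = (2^-1) ^+ 2 :> R by field.
  by rewrite /log2 lnXn // lnV ?posrE // mulrnAl mulNr divff // mulNrn.
congr (_%:E); rewrite /entropyPart !big_cons !big_nil log2_half log2_quarter.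
by field.
Qed.
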